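(* Let $(V,\mathcal{K})$ be a finite simplicial complex and $f:\mathcal{K}\to\mathbb{R}$ an injective discrete Morse function, with Lovász extension $f^L$ on $|S_\mathcal{K}|$. Then for each $m=0,1,\dots,\dim\mathcal{K}$, $$\min_{L\in\mathrm{Cat}_m(\mathcal{K})}\max_{\sigma\in L}f(\sigma)=\inf_{S\in\mathrm{Cat}_m(|S_\mathcal{K}|)}\sup_{\vec x\in S}f^L(\vec x).$$
   Context: $V=\{1,\dots,n\}$, $\mathcal{K}$ the set of nonempty faces, containing all singletons, $\mathcal{K}\ne\mathcal{P}(V)$. Order complex $S_\mathcal{K}$: simplicial complex on vertex set $\mathcal{K}$ whose simplices are chains in $\mathcal{K}$; $|S_\mathcal{K}|=\bigcup_{\text{chains }\mathcal{C}}\mathrm{conv}(\vec1_\sigma:\sigma\in\mathcal{C})\subset\mathbb{R}^V$. For $\vec x=\sum\lambda_i\vec1_{\sigma_i}$ on a chain simplex, $f^L(\vec x)=\sum\lambda_if(\sigma_i)$. Discrete Morse function: for each $p$-simplex $\sigma$, $\#\{\tau\supset\sigma:\dim\tau=p+1,f(\tau)\le f(\sigma)\}\le1$ and $\#\{\nu\subset\sigma:\dim\nu=p-1,f(\nu)\ge f(\sigma)\}\le1$. For $S\subset|S_\mathcal{K}|$, $\mathrm{cat}(S)$ is the minimal $k\in\mathbb{N}^+$ such that there exist $k+1$ sets $U_0,\dots,U_k$ covering $S$, each of whose inclusion maps into $|S_\mathcal{K}|$ is null-homotopic. $\mathrm{Cat}_m(\mathcal{K})=\{L\subset\mathcal{K}:\mathrm{cat}(|S_\mathcal{K}(L)|)\ge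 m\}$, where $S_\mathcal{K}(L)$ is the induced subcomplex of $S_\mathcal{K}$ on the vertex set $L$; $\mathrm{Cat}_m(|S_\mathcal{K}|)=\{S\subset|S_\mathcal{K}|:\mathrm{cat}(S)\ge m\}$. *)

(* Defs.v *)
From HB Require Import structures.
From mathcomp Require Import all_boot all_order all_algebra.
From mathcomp Require Import all_classical all_reals all_analysis.
Set Implicit Arguments.
Unset Strict Implicit.
Unset Printing Implicit Defensive.
Import Order.TTheory GRing.Theory Num.Theory.
Import numFieldNormedType.Exports.
Local Open Scope ring_scope.

(* A face is a nonempty subset of the vertex set 'I_n, and K is the set of the
   nonempty faces of the complex. *)
Definition simplicial_complex (n : nat) (K : {set {set 'I_n}}) : Prop :=
  [/\ finset.set0 \notin K,
      forall i : 'I_n, finset.set1 i \in K &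
      forall sigma tau : {set 'I_n}, sigma \in K -> tau \subset sigma ->
        tau != finset.set0 -> tau \in K].

Definition face_dim (n : nat) (sigma : {set 'I_n}) : nat := #|sigma|.-1.

Definition complex_dim (n : nat) (K : {set {set 'I_n}}) : nat :=
  (\max_(sigma in K) face_dim sigma)%N.

(* f is a function on K; its values outside K are irrelevant. *)
Definition discrete_morse (R : realType) (n : nat) (K : {set {set 'I_n}})
    (f : {set 'I_n} -> R) : Prop :=
  forall sigma : {set 'I_n}, sigma \in K ->
    (#|[pred tau in K | [&& sigma \subset tau,
          face_dim tau == (face_dim sigma).+1 & (f tau <= f sigma)%R]]| <= 1)%N /\
    (#|[pred nu in K | [&& nu \subset sigma,
          (face_dim nu).+1 == face_dim sigma & (f sigma <= f nu)%R]]| <= 1)%N.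

Definition is_chain (n : nat) (C : {set {set 'I_n}}) : bool :=
  [forall sigma in C, forall tau in C,
    (sigma \subset tau) || (tau \subset sigma)].

Definition order_complex (n : nat) (K : {set {set 'I_n}}) :
    {set {set {set 'I_n}}} :=
  finset (fun C : {set {set 'I_n}} =>
    [&& C \subset K, C != finset.set0 & is_chain C]).

(* Full subcomplex of T on the vertices belonging to L. *)
Definition induced (T0 : finType) (T : {set {set T0}}) (L : {set T0}) :
    {set {set T0}} :=
  finset (fun C : {set T0} => (C \in T) && (C \subset L)).

Definition indic_vec (R : realType) (n : nat) (sigma : {set 'I_n}) :
    'rV[R]_n := \row_(i < n) (i \in sigma)%:R.

(* lam writes x as a convex combination of the indicator vectors of the
   elements of C; only the values of lam on C matter. *)
Definition convex_comb (R : realType) (n : nat) (C : {set {set 'I_n}})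
    (lam : {set 'I_n} -> R) (x : 'rV[R]_n) : Prop :=
  [/\ forall sigma, sigma \in C -> 0 <= lam sigma,
      \sum_(sigma in C) lam sigma = 1 &
      x = \sum_(sigma in C) lam sigma *: indic_vec R sigma].

Local Open Scope classical_set_scope.

Definition geom (R : realType) (n : nat) (T : {set {set {set 'I_n}}}) :
    set 'rV[R]_n :=
  [set x | exists2 C, C \in T & exists lam, convex_comb C lam x].
Arguments geom R {n} T _.

(* The value does not depend on the chosen chain and coefficients, see
   lovasz_extE below; outside of the order complex the value is 0. *)
Definition lovasz_ext (R : realType) (n : nat) (K : {set {set 'I_n}})
    (f : {set 'I_n} -> R) (x : 'rV[R]_n) : R :=
  xget 0 [set y | exists2 C, C \in order_complex K &
    exists2 lam, convex_comb C lam x & y = \sum_(sigma in C) lam sigma * f sigma].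

Definition null_homotopic_in (R : realType) (T : topologicalType)
    (X U : set T) : Prop :=
  exists (c : T) (H : T * R -> T),
    [/\ X c,
        {within U `*` `[0, 1], continuous H},
        forall x t, U x -> `[0, 1] t -> X (H (x, t)),
        forall x, U x -> H (x, 0) = x &
        forall x, U x -> H (x, 1) = c].

(* S is covered by the k + 1 sets U_0, ..., U_k, which are arbitrary subsets
   of X. *)
Definition cat_cover (R : realType) (T : topologicalType) (X S : set T)
    (k : nat) : Prop :=
  exists U : 'I_k.+1 -> set T,
    [/\ forall i, U i `<=` X,
        S `<=` \bigcup_i U i &
        forall i, null_homotopic_in R X (U i)].

(* Least k >= 1 admitting a cover as above, and +oo if there is no such k. *)
Definition ls_cat (R : realType) (T : topologicalType) (X S : set T) : \bar R :=
  ereal_inf [set (k%:R : R)%:E | k in [set k | (0 < k)%N /\ cat_cover R X S k]].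

Definition Cat_simpl (R : realType) (n : nat) (K : {set {set 'I_n}}) (m : nat) :
    set {set {set 'I_n}} :=
  [set L : {set {set 'I_n}} | L \subset K /\
    ((m%:R : R)%:E <= ls_cat R (geom R (order_complex K))
                        (geom R (induced (order_complex K) L)))%E].

Definition Cat_geom (R : realType) (n : nat) (K : {set {set 'I_n}}) (m : nat) :
    set (set 'rV[R]_n) :=
  [set S | S `<=` geom R (order_complex K) /\
    ((m%:R : R)%:E <= ls_cat R (geom R (order_complex K)) S)%E].

Arguments Cat_geom R {n} K m _.

Lemma chain_coef_inj (R : realType) (n : nat) (k : nat)
    (l1 l2 : {set 'I_n} -> R) :
  (#|[pred s | l1 s != 0%R]| + #|[pred s | l2 s != 0%R]| <= k)%N ->
  (forall s, 0 <= l1 s) -> (forall s, 0 <= l2 s) ->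
  l1 finset.set0 = 0 -> l2 finset.set0 = 0 ->
  (forall s t, l1 s != 0 -> l1 t != 0 -> (s \subset t) || (t \subset s)) ->
  (forall s t, l2 s != 0 -> l2 t != 0 -> (s \subset t) || (t \subset s)) ->
  (forall i, \sum_s l1 s * (i \in s)%:R = \sum_s l2 s * (i \in s)%:R) ->
  l1 =1 l2.
Proof.
have top (l : {set 'I_n} -> R) : (exists s, l s != 0) ->
    (forall s t, l s != 0 -> l t != 0 -> (s \subset t) || (t \subset s)) ->
    exists2 M, l M != 0 & forall s, l s != 0 -> s \subset M.
  case=> s0 ls0 ch.
  case: (@arg_maxnP _ s0 (fun s => l s != 0) (fun s => #|s|) ls0) => M lM maxM.
  exists M => // s ls; have /orP[//|Ms] := ch _ _ ls lM.
  have /eqP -> // : s == M by rewrite eq_sym finset.eqEcard Ms; apply: maxM.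
have sgt0 (l : {set 'I_n} -> R) i : (forall s, 0 <= l s) ->
    0 < \sum_s l s * (i \in s)%:R -> exists2 s, l s != 0 & i \in s.
  move=> l0; apply: contraPP => h; rewrite big1 ?ltxx// => s _.
  apply/eqP; apply: contra_notT h; rewrite mulf_eq0 negb_or pnatr_eq0.
  by rewrite eqb0 negbK => /andP[? ?]; exists s.
have gt0s (l : {set 'I_n} -> R) i s : (forall s, 0 <= l s) ->
    l s != 0 -> i \in s -> 0 < \sum_s l s * (i \in s)%:R.
  move=> l0 ls is_; rewrite (bigD1 s)//= is_ mulr1 ltr_pwDl//.
    by rewrite lt_def ls l0.
  by apply: sumr_ge0 => t _; rewrite mulr_ge0// ler0n.
have sub (l l' : {set 'I_n} -> R) (M s : {set 'I_n}) : (forall s, 0 <= l s) ->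
    (forall s, 0 <= l' s) ->
    (forall i, \sum_s l s * (i \in s)%:R = \sum_s l' s * (i \in s)%:R) ->
    l s != 0 -> (forall s, l' s != 0 -> s \subset M) -> s \subset M.
  move=> l0 l0' e ls hM; apply/fintype.subsetP => i si.
  have := gt0s l i s l0 ls si; rewrite e => /(sgt0 _ _ l0')[t lt ti].
  exact: (fintype.subsetP (hM _ lt)).
elim: k l1 l2 => [|k IH] l1 l2 hk l10 l20 e1 e2 c1 c2 e.
  move: hk; rewrite leqn0 addn_eq0 => /andP[/eqP/card0_eq h1 /eqP/card0_eq h2] s.
  have := h1 s; have := h2 s; rewrite !inE.
  by move=> /negbFE/eqP -> /negbFE/eqP ->.
have [n1|z1] := pselect (exists s, l1 s != 0); last first.
  have z1' s : l1 s = 0 by apply/eqP; apply: contra_notT z1 => ?; exists s.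
  move=> s; rewrite z1'; apply/eqP; rewrite eq_sym; apply/negPn/negP => ls.
  have [s0|[i si]] := finset.set_0Vmem s; first by rewrite s0 e2 eqxx in ls.
  have := gt0s l2 i s l20 ls si; rewrite -e big1 ?ltxx// => t _.
  by rewrite z1' mul0r.
have [n2|z2] := pselect (exists s, l2 s != 0); last first.
  have z2' s : l2 s = 0 by apply/eqP; apply: contra_notT z2 => ?; exists s.
  move=> s; rewrite z2'; apply/eqP; apply/negPn/negP => ls.
  have [s0|[i si]] := finset.set_0Vmem s; first by rewrite s0 e1 eqxx in ls.
  have := gt0s l1 i s l10 ls si; rewrite e big1 ?ltxx// => t _.
  by rewrite z2' mul0r.
have [M l1M hM1] := top _ n1 c1.
have [M' l2M' hM2] := top _ n2 c2.
have MM' : M' = M.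
  apply/eqP; rewrite finset.eqEsubset.
  rewrite (sub l2 l1 M M')//=; first exact: (sub l1 l2 M' M).
subst M'.
pose c := Num.min (l1 M) (l2 M).
have cM1 : c <= l1 M by rewrite ge_min lexx.
have cM2 : c <= l2 M by rewrite ge_min lexx orbT.
have c_gt0 : 0 < c by rewrite lt_min !lt_def l1M l2M' l10 l20.
pose d (l : {set 'I_n} -> R) s := if s == M then l s - c else l s.
have supp l s : l M != 0 -> d l s != 0 -> l s != 0.
  by move=> lM; rewrite /d; case: (s =P M) => [->|].
have M0 : finset.set0 != M by apply: contraNneq l1M => <-; rewrite e1.
have dE l i : \sum_s d l s * (i \in s)%:R =
    \sum_s l s * (i \in s)%:R - c * (i \in M)%:R.
  rewrite (bigD1 M)//= [in RHS](bigD1 M)//= /d eqxx mulrBl addrAC; congr (_ + _ - _).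
  by apply: eq_bigr => s /negPf ->.
have cle l : l M != 0 -> (#|[pred s | d l s != 0%R]| <= #|[pred s | l s != 0%R]|)%N.
  by move=> lM; apply/subset_leq_card/fintype.subsetP => s; rewrite !inE; exact: supp.
have clt l : l M != 0 -> l M = c ->
    (#|[pred s | d l s != 0%R]| < #|[pred s | l s != 0%R]|)%N.
  move=> lM lc; apply: proper_card; apply/fintype.properP; split.
    by apply/fintype.subsetP => s; rewrite !inE; exact: supp.
  by exists M; rewrite !inE // /d eqxx lc subrr eqxx.
suff dd : d l1 =1 d l2.
  by move=> s; have := dd s; rewrite /d; case: (s =P M) => [->|//] /addIr.
apply: IH.
- rewrite -ltnS; apply: leq_trans hk.
  have [le12|/ltW le21] := leP (l1 M) (l2 M).
    rewrite -addSn leq_add ?cle// clt//; rewrite /c; exact/esym/min_idPl.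
  rewrite -addnS leq_add ?cle// clt//; rewrite /c; exact/esym/min_idPr.
- by move=> s; rewrite /d; case: (s =P M) => [->|//]; rewrite subr_ge0.
- by move=> s; rewrite /d; case: (s =P M) => [->|//]; rewrite subr_ge0.
- by rewrite /d (negPf M0).
- by rewrite /d (negPf M0).
- by move=> s t /(supp _ _ l1M) hs /(supp _ _ l1M); exact: c1.
- by move=> s t /(supp _ _ l2M') hs /(supp _ _ l2M'); exact: c2.
- by move=> i; rewrite !dE e.
Qed.

Lemma lovasz_extE (R : realType) (n : nat) (K : {set {set 'I_n}})
    (f : {set 'I_n} -> R) (C : {set {set 'I_n}}) (lam : {set 'I_n} -> R)
    (x : 'rV[R]_n) :
  simplicial_complex K -> C \in order_complex K -> convex_comb C lam x ->
  lovasz_ext K f x = \sum_(sigma in C) lam sigma * f sigma.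
Proof.
case=> K0 _ _ CK xC; rewrite /lovasz_ext; case: xgetP => [y -> /= |]; last first.
  by move=> /(_ (\sum_(sigma in C) lam sigma * f sigma))[]; exists C => //; exists lam.
case=> C' C'K [lam' xC' ->].
have ext A (l g : {set 'I_n} -> R) : \sum_(s in A) l s * g s =
    \sum_s (if s \in A then l s else 0) * g s.
  by rewrite big_mkcond; apply: eq_bigr => s _; case: ifP => //; rewrite mul0r.
have coord A l : convex_comb A l x -> forall i,
    \sum_s (if s \in A then l s else 0) * (i \in s)%:R = x ord0 i.
  case=> _ _ xE i; rewrite -ext xE summxE.
  by apply: eq_bigr => s _; rewrite !mxE.
have nz (A : {set {set 'I_n}}) (l : {set 'I_n} -> R) s : (if s \in A then l s else 0) != 0 -> s \in A.
  by case: ifP => //; rewrite eqxx.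
have ch (A : {set {set 'I_n}}) (l : {set 'I_n} -> R) s t :
    A \in order_complex K ->
    (if s \in A then l s else 0) != 0 -> (if t \in A then l t else 0) != 0 ->
    (s \subset t) || (t \subset s).
  rewrite inE => /and3P[_ _ /forall_inP cA] hs ht.
  by have /forall_inP := cA _ (nz _ _ _ hs); apply; exact: nz ht.
have z A (l : {set 'I_n} -> R) : A \in order_complex K ->
    (if finset.set0 \in A then l finset.set0 else 0) = 0.
  rewrite inE => /and3P[/fintype.subsetP AK _ _]; case: ifP => // /AK.
  by rewrite (negPf K0).
have nn A l s : convex_comb A l x -> 0 <= (if s \in A then l s else 0).
  by case=> h _ _; case: ifP => // /h.
rewrite !ext; apply: eq_bigr => s _; congr (_ * _).
apply: (@chain_coef_inj R n _ (fun s => if s \in C' then lam' s else 0)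
   (fun s => if s \in C then lam s else 0) (leqnn _)) => //.
- by move=> ?; exact: nn.
- by move=> ?; exact: nn.
- exact: z.
- exact: z.
- by move=> ? ?; exact: ch.
- by move=> ? ?; exact: ch.
- by move=> i; rewrite !coord.
Qed.

(* Main.v *)
(* Let S have cat(S) >= m, let t be the supremum of f^L on S and L the set of
   faces s with f(s) <= t.  Since f^L(x) is a mean of the values of f on the
   carrier chain of x, the carrier of every x in S meets L.  Hence S deforms
   inside |S_K| onto a part of |S_K(L)|: move x linearly, within its carrier
   simplex, to the point r(x) carried by the carrier faces in L.  Pulling back
   along r a categorical cover of |S_K(L)| gives one of S, so
   cat(|S_K(L)|) >= cat(S) >= m, whereas f <= t on L.  Conversely f^L is at most
   max_L f on |S_K(L)|. *)
Require Import Defs.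
From mathcomp Require Import all_boot all_order all_algebra.
From mathcomp Require Import all_classical all_reals all_analysis.
Import Order.TTheory GRing.Theory Num.Theory.
Import numFieldNormedType.Exports.
Local Open Scope classical_set_scope.
Local Open Scope ring_scope.

(** * Continuous weights that detect the carrier of a point *)

(* A stand-in for the barycentric coordinate of s that is visibly continuous on
   the whole space: it is positive exactly when s is a superlevel set {x >= c}
   with c > 0, and on |S_K| these sets are the faces with a positive coefficient. *)
Definition face_weight {R : realType} {n : nat} (s : {set 'I_n})
    (x : 'rV[R]_n) : R :=
  \prod_(i in s) (Num.max 0 (x ord0 i) *
    \prod_(j in ~: s) Num.max 0 (x ord0 i - x ord0 j)).

Lemma face_weight_ge0 {R : realType} {n : nat} (s : {set 'I_n}) (x : 'rV[R]_n) :
  0 <= face_weight s x.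
Proof.
apply: prodr_ge0 => i _; rewrite mulr_ge0 ?le_max ?lexx//.
by apply: prodr_ge0 => j _; rewrite le_max lexx.
Qed.

Lemma prodr_gt0P {R : realDomainType} {I : finType} (P : pred I) (F : I -> R) :
  (forall i, P i -> 0 <= F i) ->
  reflect (forall i, P i -> 0 < F i) (0 < \prod_(i | P i) F i).
Proof.
move=> F0; apply: (iffP idP) => [|h]; last exact: prodr_gt0.
by move=> /lt0r_neq0/prodf_neq0 h i Pi; rewrite lt_def h//= F0.
Qed.

Lemma face_weight_gt0P {R : realType} {n : nat} (s : {set 'I_n}) (x : 'rV[R]_n) :
  reflect (forall i, i \in s ->
             0 < x ord0 i /\ (forall j, j \notin s -> x ord0 j < x ord0 i))
          (0 < face_weight s x).
Proof.
have p0 i : 0 <= \prod_(j in ~: s) Num.max 0 (x ord0 i - x ord0 j).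
  by apply: prodr_ge0 => j _; rewrite le_max lexx.
apply: (iffP (prodr_gt0P _ _ _)) => [i _|h i si|h i si].
- by rewrite mulr_ge0 ?le_max ?lexx.
- have := h i si; have [x0|x0] := ltP 0 (x ord0 i); last by rewrite mul0r ltxx.
  rewrite pmulr_rgt0// => /prodr_gt0P hj; split=> // j sj.
  have : 0 < Num.max 0 (x ord0 i - x ord0 j).
    by apply: hj => [k _|]; rewrite ?le_max ?lexx// finset.in_setC.
  by rewrite lt_max ltxx subr_gt0.
- have [x0 hj] := h i si; rewrite pmulr_lgt0 ?lt_max ?x0 ?orbT//.
  by apply: prodr_gt0 => j; rewrite finset.in_setC lt_max subr_gt0 => /hj ->; rewrite orbT.
Qed.

Lemma cvg_maxr {R : realType} {T : Type} (F : set_system T) {FF : Filter F}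
    (f g : T -> R) (a b : R) :
  f x @[x --> F] --> a -> g x @[x --> F] --> b ->
  Num.max (f x) (g x) @[x --> F] --> Num.max a b.
Proof. by apply: continuous2_cvg; exact: (@max_continuous _ R (a, b)). Qed.

Lemma face_weight_continuous {R : realType} {n : nat} (s : {set 'I_n}) :
  continuous (@face_weight R n s).
Proof.
move=> x.
have coord k : (y ord0 k : R) @[y --> x] --> (x ord0 k : R).
  exact: coord_continuous.
have max0 (g : 'rV[R]_n -> R) b : g y @[y --> x] --> b ->
    Num.max 0 (g y) @[y --> x] --> Num.max 0 b.
  by move=> ?; apply: (@cvg_maxr _ _ (nbhs x)) => //; exact: cvg_cst.
apply: (cvg_big (F := nbhs x) (@mul_continuous R)) => i _.
apply: (@cvgM _ _ (nbhs x)); first exact: max0 (coord i).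
apply: (cvg_big (F := nbhs x) (@mul_continuous R)) => j _.
exact: max0 (@cvgB _ _ _ (nbhs x) _ _ _ _ _ (coord i) (coord j)).
Qed.

Lemma convex_comb_coord {R : realType} {n : nat} {C : {set {set 'I_n}}}
    {lam : {set 'I_n} -> R} {x : 'rV[R]_n} (i : 'I_n) :
  convex_comb C lam x ->
  x ord0 i = \sum_(s in C) lam s * (i \in s)%:R.
Proof.
by case=> _ _ ->; rewrite summxE; apply: eq_bigr => s _; rewrite !mxE.
Qed.

Lemma chain_cmp {n : nat} {C : {set {set 'I_n}}} : is_chain C ->
  {in C &, forall s t : {set 'I_n}, (s \subset t) || (t \subset s)}.
Proof. by move=> /forall_inP h s t sC tC; have /forall_inP := h _ sC; exact. Qed.

(** Let [t] be the smallest member of the chain containing [s]. If some [j] lay in [t] but not in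
    [s], then each [i] in [s] has a larger coordinate than [j], so some member contains [i] and
    omits [j]; the largest such member contains [s] and is strictly below [t]. The empty set is
    excluded because its weight is an empty product, equal to 1. *)
Lemma face_weight_carrier {R : realType} {n : nat} {C : {set {set 'I_n}}}
    {lam : {set 'I_n} -> R} {x : 'rV[R]_n} (s : {set 'I_n}) :
  is_chain C -> convex_comb C lam x -> s != finset.set0 ->
  0 < face_weight s x -> s \in C.
Proof.
move=> /chain_cmp cC xC s0 /face_weight_gt0P ws.
have lam0 : forall t, t \in C -> 0 <= lam t by case: xC.
have [i0 si0] : exists i, i \in s by exact/finset.set0Pn.
(* In a chain, if each point of [s] lies in a member satisfying [Q], then the largest member
   satisfying [Q] contains all of [s]. *)
have above (Q : pred {set 'I_n}) : {in s, forall i, exists2 t,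
    (t \in C) && Q t & i \in t} -> exists2 t, (t \in C) && Q t & s \subset t.
  move=> h; have [t0 t0C _] := h i0 si0.
  case: (@arg_maxnP _ t0 (fun t => (t \in C) && Q t) (fun t => #|t|) t0C).
  move=> t /andP[tC Qt] tmax; exists t; first by rewrite tC.
  apply/fintype.subsetP => i si; have [u /andP[uC Qu] iu] := h i si.
  have /orP[ut|tu] := cC _ _ uC tC; first exact: (fintype.subsetP ut).
  suff -> : t = u by [].
  by apply/eqP; rewrite finset.eqEcard tu; apply: tmax; rewrite uC.
have [t0 /andP[t0C _] st0] : exists2 t, (t \in C) && xpredT t & s \subset t.
  apply: above => i si; have [+ _] := ws i si.
  rewrite (convex_comb_coord i xC); apply: contraPP => h.
  rewrite big1 ?ltxx// => t tC; case: (boolP (i \in t)) => [it|_]; last by rewrite mulr0.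
  by case: h; exists t; rewrite ?tC.
have t0P : (t0 \in C) && (s \subset t0) by rewrite t0C.
case: (@arg_minnP _ t0 (fun t => (t \in C) && (s \subset t)) (fun t => #|t|) t0P).
move=> t /andP[tC st] tmin.
suff -> : s = t by [].
apply/eqP; rewrite finset.eqEsubset st /=; apply/fintype.subsetP => j jt.
apply: contraT => js.
have [u /andP[uC ju] su] : exists2 u, (u \in C) && (j \notin u) & s \subset u.
  apply: above => i si; have [_ /(_ j js)] := ws i si.
  rewrite !(convex_comb_coord _ xC); apply: contraPP => h.
  apply/negP; rewrite -leNgt; apply: ler_sum => u uC.
  rewrite ler_wpM2l ?lam0// ler_nat; case: (boolP (i \in u)) => // iu.
  by case: (boolP (j \in u)) => // ju; case: h; exists u; rewrite ?uC.
have := tmin u; rewrite uC su => /(_ isT) tu.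
have /orP[/fintype.subsetP/(_ j jt)|ut] := cC _ _ tC uC; first by rewrite (negPf ju).
have /eqP eut : u == t by rewrite finset.eqEcard ut.
by rewrite eut jt in ju.
Qed.

(** A chain member containing some [j] outside [s] must contain [s]. Hence for [i] in [s] coordinate
    [i] exceeds coordinate [j] by at least [lam s]. *)
Lemma face_weight_support {R : realType} {n : nat} {C : {set {set 'I_n}}}
    {lam : {set 'I_n} -> R} {x : 'rV[R]_n} (s : {set 'I_n}) :
  is_chain C -> convex_comb C lam x -> s \in C -> 0 < lam s ->
  0 < face_weight s x.
Proof.
move=> /chain_cmp cC xC sC ls; apply/face_weight_gt0P => i si.
have lam0 : forall t, t \in C -> 0 <= lam t by case: xC.
rewrite (convex_comb_coord _ xC) (bigD1 s)//= si mulr1; split.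
  rewrite ltr_pwDl// sumr_ge0// => t /andP[tC _].
  by rewrite mulr_ge0 ?lam0.
move=> j sj; rewrite (convex_comb_coord _ xC) (bigD1 s)//= (negPf sj) mulr0.
rewrite ltr_leD// ler_sum// => t /andP[tC _]; rewrite ler_wpM2l ?lam0// ler_nat.
case: (boolP (j \in t)) => // jt.
have /orP[/fintype.subsetP ->//|/fintype.subsetP/(_ j jt)] := cC _ _ sC tC.
by rewrite (negPf sj).
Qed.

(** * The retraction towards the subcomplex on [L] *)

(** A weighted mean over all of [L], with no reference to a carrier chain, so that continuity can be
    read off the formula; on the order complex only carrier faces of [x] get a nonzero weight. *)
Definition face_retract {R : realType} {n : nat} (L : {set {set 'I_n}})
    (x : 'rV[R]_n) : 'rV[R]_n :=
  (\sum_(s in L) face_weight s x)^-1 *: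
    \sum_(s in L) face_weight s x *: indic_vec R s.

Lemma face_retract_cvg {R : realType} {n : nat} (L : {set {set 'I_n}})
    (x : 'rV[R]_n) :
  0 < \sum_(s in L) face_weight s x ->
  face_retract L y @[y --> x] --> face_retract L x.
Proof.
move=> a0; apply: (@cvgZ _ _ _ (nbhs x)).
  apply: (@cvgV _ _ (nbhs x)); first by rewrite gt_eqF.
  apply: (cvg_big (F := nbhs x) (@add_continuous _)) => s _.
  exact: face_weight_continuous.
apply: (cvg_big (F := nbhs x) (@add_continuous _)) => s _.
apply: (@cvgZ _ _ _ (nbhs x)); last exact: cvg_cst.
exact: face_weight_continuous.
Qed.

Section retract_carrier.
Context {R : realType} {n : nat} (K L C : {set {set 'I_n}})
  (lam : {set 'I_n} -> R) (x : 'rV[R]_n) (s0 : {set 'I_n}).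
Hypotheses (K0 : finset.set0 \notin K) (LK : L \subset K)
  (CK : C \in order_complex K) (xC : convex_comb C lam x)
  (s0C : s0 \in C) (s0L : s0 \in L) (ls0 : 0 < lam s0).

Let cC : is_chain C. Proof. by move: CK; rewrite inE => /and3P[]. Qed.

Lemma face_retract_den_gt0 : 0 < \sum_(s in L) face_weight s x.
Proof.
rewrite (bigD1 s0)//= ltr_pwDl ?(face_weight_support _ cC xC)//.
by apply: sumr_ge0 => *; exact: face_weight_ge0.
Qed.

(** By [face_weight_carrier], faces of [L] outside [C] have weight zero. *)
Let sumCL {V : zmodType} (F : {set 'I_n} -> V) :
  (forall s, face_weight s x = 0 -> F s = 0) ->
  \sum_(s in L) F s = \sum_(s in C :&: L) F s.
Proof.
move=> F0; rewrite (big_setID C)/= addrC big1 ?add0r.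
  by apply: eq_bigl => s; rewrite !inE andbC.
move=> s; rewrite inE => /andP[sC sL]; apply: F0; apply/eqP.
rewrite eq_le face_weight_ge0 andbT leNgt; apply: contra sC.
apply: face_weight_carrier cC xC _; apply: contraNneq K0 => <-.
exact: (fintype.subsetP LK).
Qed.

Let mu s := (\sum_(t in L) face_weight t x)^-1 * face_weight s x.

Lemma face_retract_convex : convex_comb (C :&: L) mu (face_retract L x).
Proof.
have a0 := face_retract_den_gt0; split.
- by move=> s _; rewrite mulr_ge0 ?invr_ge0 ?(ltW a0)// face_weight_ge0.
- rewrite -sumCL; last by move=> s; rewrite /mu => ->; rewrite mulr0.
  by rewrite -mulr_sumr mulVf ?gt_eqF.
- rewrite -sumCL; last by move=> s; rewrite /mu => ->; rewrite mulr0 scale0r.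
  by rewrite /face_retract scaler_sumr; apply: eq_bigr => s _; rewrite scalerA.
Qed.

Lemma face_retract_geom : geom R (Defs.induced (order_complex K) L) (face_retract L x).
Proof.
exists (C :&: L); last by exists mu; exact: face_retract_convex.
move: CK; rewrite !inE => /and3P[CsK C0 _]; rewrite finset.subsetIr andbT.
rewrite (fintype.subset_trans (finset.subsetIl _ _) CsK) /=; apply/andP; split.
  by apply/finset.set0Pn; exists s0; rewrite inE s0C.
apply/forall_inP => s; rewrite inE => /andP[sC _].
apply/forall_inP => t; rewrite inE => /andP[tC _].
exact: chain_cmp cC _ _ sC tC.
Qed.

(** Both endpoints are convex combinations over the same chain [C], so the segment stays in one
    simplex. *)
Lemma face_retract_segment (u : R) : 0 <= u <= 1 ->
  geom R (order_complex K) (face_retract L x + u *: (x - face_retract L x)).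
Proof.
move=> /andP[u0 u1]; exists C => //.
exists (fun s => u * lam s + (1 - u) * (if s \in L then mu s else 0)).
have [m0 m1 mE] := face_retract_convex; have [l0 l1 lE] := xC.
(* Extension by zero brings the coefficients of the retracted point from [C :&: L] to [C]. *)
have CL (V : zmodType) (F : {set 'I_n} -> V) :
    \sum_(s in C :&: L) F s = \sum_(s in C) if s \in L then F s else 0.
  by rewrite -big_mkcondr; apply: eq_bigl => s; rewrite inE.
split.
- move=> s sC; rewrite addr_ge0 ?mulr_ge0 ?l0 ?subr_ge0//.
  by case: ifP => // sL; apply: m0; rewrite inE sC.
- by rewrite big_split/= -!mulr_sumr l1 -CL m1 !mulr1 addrC subrK.
- rewrite [in LHS]scalerBr addrCA -{1}[face_retract L x]scale1r -scalerBl.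
  rewrite {1}lE mE CL !scaler_sumr -big_split; apply: eq_bigr => s _ /=.
  by rewrite scalerDl !scalerA; case: ifP; rewrite ?scalerA// !(mulr0, scaler0, scale0r).
Qed.

End retract_carrier.

(** * Pulling back categorical covers *)

(** The preimages of the [U i] under [r] cover [S]; each contracts in [X] by first sliding along the
    segments to [r x], then following the contraction of [U i]. *)
Lemma cat_cover_retract {R : realType} {n : nat} (X A S : set 'rV[R]_n)
    (r : 'rV[R]_n -> 'rV[R]_n) (k : nat) :
  S `<=` X ->
  (forall x, S x -> r y @[y --> x] --> r x) ->
  (forall x, S x -> A (r x)) ->
  (forall x u, S x -> 0 <= u <= 1 -> X (r x + u *: (x - r x))) ->
  cat_cover R X A k -> cat_cover R X S k.
Proof.
move=> SX cr Ar seg [U [UX AU HU]].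
exists (fun i => S `&` r @^-1` (U i)); split.
- by move=> i x [/SX].
- by move=> x Sx; have [i _ Ui] := AU _ (Ar x Sx); exists i.
move=> i; have [c [H [Xc cH XH H0 H1]]] := HU i.
(* Clipping lets one formula describe both stages: [v] stays 0 while [u] falls from 1 to 0, then [u]
   stays 0 while [v] rises to 1. Continuity then needs no gluing at 1/2. *)
pose v (t : R) := Num.max 0 (2 * t - 1).
pose u (t : R) := Num.max 0 (1 - 2 * t).
have v01 t : `[0, 1]%classic t -> `[0, 1]%classic (v t).
  rewrite /= !in_itv/= => /andP[t0 t1]; rewrite le_max lexx ge_max ler01 /=.
  by rewrite lerBlDr -[leRHS]mulr1 ler_pM2l.
have u01 t : `[0, 1]%classic t -> 0 <= u t <= 1.
  rewrite /= !in_itv/= => /andP[t0 t1]; rewrite le_max lexx ge_max ler01 /=.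
  by rewrite lerBlDr lerDl mulr_ge0.
(* On [0, 1/2] this is the segment from x to r x, on [1/2, 1] it is H at r x. *)
exists c, (fun p => H (r p.1, v p.2) + u p.2 *: (p.1 - r p.1)); split => //.
- apply/subspace_continuousP => -[x t] [[/= Sx Ux] t01].
  set F := within _ _.
  have FF : Filter F by exact: within_filter.
  have c1 : p.1 @[p --> F] --> x.
    by apply: cvg_trans (cvg_fst (F := nbhs x) (G := nbhs t)); apply: cvg_app; exact: cvg_within.
  have c2 : p.2 @[p --> F] --> t.
    by apply: cvg_trans (cvg_snd (F := nbhs x) (G := nbhs t)); apply: cvg_app; exact: cvg_within.
  have c2t : 2 * p.2 @[p --> F] --> 2 * t.
    by apply: (@cvgM _ _ F) => //; exact: cvg_cst.
  have crx : r p.1 @[p --> F] --> r x by apply: cvg_comp c1 (cr x Sx).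
  have cv : v p.2 @[p --> F] --> v t.
    apply: (@cvg_maxr _ _ F); first exact: cvg_cst.
    by apply: (@cvgB _ _ _ F) => //; exact: cvg_cst.
  have cu : u p.2 @[p --> F] --> u t.
    apply: (@cvg_maxr _ _ F); first exact: cvg_cst.
    by apply: (@cvgB _ _ _ F) => //; exact: cvg_cst.
  have cZ : u p.2 *: (p.1 - r p.1) @[p --> F] --> u t *: (x - r x).
    have cxr := @cvgB _ _ _ F FF _ _ _ _ c1 crx.
    exact: (@cvgZ _ _ _ F FF _ _ _ _ cu cxr).
  (* [H] is continuous only relative to [U i] times the unit interval; the restriction built into
     [F] keeps [(r p.1, v p.2)] there. *)
  have cHr : H (r p.1, v p.2) @[p --> F] --> H (r x, v t).
    have UI : (U i `*` `[0, 1]%classic) (r x, v t) by split => //=; exact: v01.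
    have /subspace_continuousP/(_ _ UI) := cH; apply: cvg_comp => B nB.
    have /= := @cvg_pair _ _ _ F _ _ FF _ _ _ _ crx cv _ nB.
    rewrite /F !nbhs_simpl /= /within /=.
    move=> /(_ _ _); apply: (@filterS _ (nbhs (x, t))) => -[y s] /= h [[Sy Uy] s01].
    by apply: h => //; split => //=; exact: v01.
  exact: (@cvgD _ _ _ F _ _ _ _ _ cHr cZ).
- move=> x t [/= Sx Ux] t01; have [t2|t2] := leP (2 * t) 1.
    have -> : v t = 0 by apply/max_idPl; rewrite subr_le0.
    by rewrite H0//; apply: seg => //; exact: u01.
  have -> : u t = 0 by apply/max_idPl; rewrite subr_le0 ltW.
  by rewrite scale0r addr0; apply: XH => //; exact: v01.
- move=> x [/= Sx Ux]; rewrite /u /v mulr0 sub0r subr0.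
  rewrite (max_idPl _) ?oppr_le0// H0// (max_idPr _)// scale1r addrC subrK//.
- move=> x [/= Sx Ux]; rewrite /u /v mulr1.
  have e21 : 2 - 1 = 1 :> R by apply/eqP; rewrite subr_eq.
  rewrite -(opprB 2) !e21.
  by rewrite (max_idPr _)// H1// (max_idPl _) ?oppr_le0// scale0r addr0.
Qed.

Lemma le_ls_cat {R : realType} {T : topologicalType} (X A B : set T) :
  (forall k, cat_cover R X B k -> cat_cover R X A k) ->
  (ls_cat R X A <= ls_cat R X B)%E.
Proof.
move=> AB; apply: ereal_inf_le_tmp => _ [k [k0 Bk] <-].
by exists k => //; split => //; exact: AB.
Qed.

(** * Bounds on the Lovász extension *)

(** Otherwise the deviations from the mean, weighted by [lam], would be nonnegative with sum zero,
    forcing every coefficient to vanish although they sum to 1. *)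
Lemma convex_comb_le_mean {R : realType} {n : nat} {C : {set {set 'I_n}}}
    {lam : {set 'I_n} -> R} {x : 'rV[R]_n} (f : {set 'I_n} -> R) :
  convex_comb C lam x ->
  exists2 s, s \in C /\ 0 < lam s & f s <= \sum_(t in C) lam t * f t.
Proof.
move=> [l0 l1 _]; set a := \sum_(t in C) _.
apply: contrapT => h.
have lt_af s : s \in C -> 0 < lam s -> a < f s.
  by move=> sC ls; rewrite ltNge; apply/negP => fs; apply: h; exists s.
have ge0 s : s \in C -> 0 <= lam s * (f s - a).
  move=> sC; have := l0 s sC; rewrite le_eqVlt => /predU1P[<-|ls].
    by rewrite mul0r.
  by rewrite mulr_ge0 ?(ltW ls)// subr_ge0 ltW// lt_af.
have sum0 : \sum_(s in C) lam s * (f s - a) = 0.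
  under eq_bigr do rewrite mulrBr.
  by rewrite sumrB -mulr_suml l1 mul1r subrr.
have lam0 s : s \in C -> lam s = 0.
  move=> sC; apply/eqP; rewrite eq_le l0// andbT leNgt; apply/negP => ls.
  have := psumr_eq0P ge0 sum0 sC; apply/eqP.
  by rewrite gt_eqF// mulr_gt0// subr_gt0 lt_af.
by move: l1; rewrite big1 // => /esym/eqP; rewrite oner_eq0.
Qed.

Lemma lovasz_ext_le_max {R : realType} {n : nat} (K L : {set {set 'I_n}})
    (f : {set 'I_n} -> R) (x : 'rV[R]_n) :
  simplicial_complex K -> geom R (Defs.induced (order_complex K) L) x ->
  ((lovasz_ext K f x)%:E <= \big[maxe/-oo]_(s in L) (f s)%:E)%E.
Proof.
move=> HK [C]; rewrite inE => /andP[CK CL] [lam xC].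
rewrite (lovasz_extE f HK CK xC).
(* Applied to [- f], the mean bound yields a face whose value is at least the mean. *)
have xCN := xC; case: (convex_comb_le_mean (fun s => - f s) xCN) => s [sC _].
under eq_bigr do rewrite mulrN.
rewrite sumrN lerN2 => le_f.
apply: (bigmax_sup s); first exact: (fintype.subsetP CL).
by rewrite lee_fin.
Qed.

Lemma geom_induced_neq0 {R : realType} {n : nat} (K L : {set {set 'I_n}}) :
  L \subset K -> L != finset.set0 ->
  geom R (Defs.induced (order_complex K) L) !=set0.
Proof.
move=> LK /finset.set0Pn[s sL]; exists (indic_vec R s), (finset.set1 s).
  rewrite !inE !finset.sub1set sL (fintype.subsetP LK)//= andbT.
  apply/andP; split; first by apply/finset.set0Pn; exists s; rewrite inE.
  apply/forall_inP => t; rewrite inE => /eqP ->.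
  by apply/forall_inP => u; rewrite inE => /eqP ->; rewrite fintype.subxx.
exists (fun=> 1); split => [t _||]; first exact: ler01.
- by rewrite finset.big_set1.
- by rewrite finset.big_set1 scale1r.
Qed.

(** * The two inequalities *)

Theorem theorem4p14 (R : realType) (n : nat) (K : {set {set 'I_n}})
    (HK : simplicial_complex K)
    (HKneq : K != finset (fun sigma : {set 'I_n} => sigma != finset.set0))
    (f : {set 'I_n} -> R)
    (finj : {in K &, injective f})
    (fmorse : discrete_morse K f)
    (m : nat) (Hm : (m <= complex_dim K)%N) :
  \big[mine/+oo%E]_(L : {set {set 'I_n}}
                      | (L \in Cat_simpl R K m) && (L != finset.set0))
     \big[maxe/-oo%E]_(sigma in L) (f sigma)%:E
  = ereal_inf [set ereal_sup [set (lovasz_ext K f x)%:E | x in S]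
              | S in [set S | Cat_geom R K m S /\ S !=set0]].
Proof.
have K0 : finset.set0 \notin K by case: HK.
apply/eqP; rewrite eq_le; apply/andP; split.
  apply: le_ereal_inf_tmp => _ [S [[SX mS] [y Sy]] <-].
  set e := ereal_sup _.
  pose L := finset (fun s => (s \in K) && ((f s)%:E <= e)%E).
  have LK : L \subset K.
    by apply/fintype.subsetP => s; rewrite inE => /andP[].
  (* The face comes from the mean bound: its value is at most the Lovász extension at [x], hence at
     most [e]. Its positive coefficient makes the denominator of [face_retract L x] positive. *)
  have carrier x : S x -> exists C lam s, [/\ C \in order_complex K,
      convex_comb C lam x, s \in C, s \in L & 0 < lam s].
    move=> Sx; have [C CK [lam xC]] := SX x Sx; exists C, lam.
    have [s [sC ls] fs] := convex_comb_le_mean f xC; exists s; split => //.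
    have CsK : C \subset K by move: CK; rewrite inE => /and3P[].
    rewrite inE (fintype.subsetP CsK)//=.
    apply: (@le_trans _ _ (lovasz_ext K f x)%:E).
      by rewrite (lovasz_extE f HK CK xC) lee_fin.
    by apply: ereal_sup_ubound; exists x.
  apply: (bigmin_inf L); last first.
    by apply/bigmax_leP; split => [|s]; rewrite ?leNye// inE => /andP[].
  apply/andP; split; last first.
    have [C [lam [s [_ _ _ sL _]]]] := carrier y Sy.
    by apply/finset.set0Pn; exists s.
  rewrite in_setE; split => //; apply: le_trans mS _; apply: le_ls_cat => k.
  apply: (@cat_cover_retract _ _ _ _ _ (face_retract L)) => //.
  - move=> x /carrier[C [lam [s [CK xC sC sL ls]]]].
    apply: face_retract_cvg; exact: face_retract_den_gt0 CK xC sC sL ls.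
  - move=> x /carrier[C [lam [s [CK xC sC sL ls]]]].
    exact: face_retract_geom K0 LK CK xC sC sL ls.
  - move=> x u /carrier[C [lam [s [CK xC sC sL ls]]]].
    exact: face_retract_segment K0 LK CK xC sC sL ls _.
(* Conversely, the realization of [L] is itself an admissible [S]. *)
apply: le_bigmin; first exact: leey.
move=> L /andP[]; rewrite in_setE => -[LK mL] L0.
set S := geom R (Defs.induced (order_complex K) L).
apply: (@le_trans _ _ (ereal_sup [set (lovasz_ext K f x)%:E | x in S])).
  apply: ereal_inf_lbound; exists S => //; split; last exact: geom_induced_neq0.
  by split => // x [C]; rewrite inE => /andP[CK _] xC; exists C.
by apply: ge_ereal_sup => _ [x Sx <-]; exact: lovasz_ext_le_max.
Qed.
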